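(* For every threshold graph $G$, the number of maximal independent sets of $G$ equals $\omega(G)$. Moreover, if $G$ is a threshold graph on $n$ vertices given by a creation sequence, then all maximal independent sets of $G$ can be counted in time $O(n)$ and enumerated in time $O(\omega(G)\cdot n)$.
   Context: All graphs are finite, simple and undirected. A graph $G=(V,E)$ is a threshold graph if there exist non-negative reals $w_v$ ($v\in V$) and $T$ such that for every $U\subseteq V$ one has $\sum_{v\in U}w_v\le T$ if and only if $U$ is independent in $G$. Equivalently, $G$ can be built from a single vertex by repeatedly adding an isolated vertex or a dominating vertex. A creation sequence for a threshold graph $G$ with $V=\{v_1,\ldots,v_n\}$ is a binary string $t=t_1\ldots t_n$ with $t_1=1$, together with a bijection $v:\{1,\ldots,n\}\to V$, such that for each $i\ge 2$: $t_i=1$ if $v(i)$ is adjacent to all of $v(1),\ldots,v(i-1)$ (a dominating vertex in the graph induced by $\{v(1),\ldots,v(i)\}$), and $t_i=0$ if $v(i)$ is adjacent to none of them (an isolated vertex there). $\omega(G)$ is the size of a largest clique of $G$. A maximal independent set is an independent set not properly contained in another independent set. *)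

(* Defs.v *)
From HB Require Import structures.
From mathcomp Require Import all_boot all_order all_algebra.
From mathcomp Require Import reals.

Set Implicit Arguments.
Unset Strict Implicit.
Unset Printing Implicit Defensive.

Import Order.TTheory GRing.Theory Num.Theory.

Record sgraph (V : finType) := SGraph {
  adj : rel V;
  adj_sym : symmetric adj;
  adj_irrefl : irreflexive adj
}.

Section Graphs.
Variable V : finType.
Implicit Types (G : sgraph V) (A K U : {set V}).

Definition independent G A : bool :=
  [forall x in A, forall y in A, ~~ adj G x y].

Definition clique G K : bool :=
  [forall x in K, forall y in K, (x != y) ==> adj G x y].

Definition omega G : nat := \max_(K : {set V} | clique G K) #|K|.

Definition max_indep_sets G : {set {set V}} :=
  [set A : {set V} | maxset (independent G) A].

Definition threshold_graph (R : realType) G : Prop :=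
  exists (w : V -> R) (T : R),
    [/\ forall x, (0 <= w x)%R,
        (0 <= T)%R &
        forall U : {set V}, (\sum_(x in U) w x <= T)%R <-> independent G U].

(* Positions are numbered from 0, so the first letter t_1 is nth false t 0;
   requiring it to be 1 (true) forces 0 < n. *)
Definition creation_sequence G (n : nat) (t : n.-tuple bool) (v : 'I_n -> V)
    : Prop :=
  [/\ bijective v,
      nth false t 0 = true &
      forall i : 'I_n, 0 < i ->
        if tnth t i then forall j : 'I_n, j < i -> adj G (v i) (v j)
        else forall j : 'I_n, j < i -> ~~ adj G (v i) (v j)].

End Graphs.

(* Random access machine in the style of Cook and Reckhow, with unit cost per
   executed instruction, a read-only input tape and a write-only output tape,
   over words bounded by W: an instruction whose result is not < W faults. *)
Inductive instr : Type :=
  | IConst of nat & nat         (* IConst i c  : X_i <- c *)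
  | IAdd   of nat & nat & nat   (* IAdd i j k  : X_i <- X_j + X_k *)
  | ISub   of nat & nat & nat   (* ISub i j k  : X_i <- X_j - X_k, truncated *)
  | IGet   of nat & nat         (* IGet i j    : X_i <- X_(X_j) *)
  | IPut   of nat & nat         (* IPut i j    : X_(X_i) <- X_j *)
  | IJpos  of nat & nat         (* IJpos j m   : if X_j > 0 then goto m *)
  | IRead  of nat               (* IRead i     : X_i <- next input word *)
  | IPrint of nat               (* IPrint j    : append X_j to the output *)
  | IHalt.

Definition program := seq instr.

Record state := State {
  pc : nat;
  mem : nat -> nat;
  inp : seq nat;
  out : seq nat
}.

Definition fetch (p : program) (s : state) : instr := nth IHalt p (pc s).

Definition write (W : nat) (s : state) (a x : nat) : option state :=
  if x < W then
    Some (State (pc s).+1 (fun b => if b == a then x else mem s b)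
                (inp s) (out s))
  else None.

(* None on a halted machine and on a fault (word overflow, reading past the
   end of the input). *)
Definition step (W : nat) (p : program) (s : state) : option state :=
  let X := mem s in
  match fetch p s with
  | IConst i c => write W s i c
  | IAdd i j k => write W s i (X j + X k)
  | ISub i j k => write W s i (X j - X k)
  | IGet i j => write W s i (X (X j))
  | IPut i j => write W s (X i) (X j)
  | IJpos j m =>
      Some (State (if 0 < X j then m else (pc s).+1) X (inp s) (out s))
  | IRead i =>
      if inp s is x :: inp' then write W (State (pc s) X inp' (out s)) i x
      else None
  | IPrint j => Some (State (pc s).+1 X (inp s) (rcons (out s) (X j)))
  | IHalt => None
  end.

Definition steps (W : nat) (p : program) (k : nat) (s : state) : option state :=
  iter k (obind (step W p)) (Some s).

Definition halted (p : program) (s : state) : bool :=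
  if fetch p s is IHalt then true else false.

Definition initial (input : seq nat) : state :=
  State 0 (fun=> 0) input [::].

(* Only a run reaching IHalt counts; a faulting run computes nothing. *)
Definition computes_within (W : nat) (p : program) (T : nat)
    (input output : seq nat) : Prop :=
  exists (k : nat) (s : state),
    [/\ k <= T, steps W p k (initial input) = Some s, halted p s
      & out s = output].

Section Encoding.
Variable V : finType.

Definition label (x : V) : nat := enum_rank x.

(* n, then t_1 ... t_n, then the labels of v(1), ..., v(n). *)
Definition encode_creation (n : nat) (t : n.-tuple bool) (v : 'I_n -> V)
    : seq nat :=
  n :: [seq nat_of_bool b | b <- t] ++ [seq label (v i) | i <- enum 'I_n].

(* Each listed set is written as its size followed by the labels of its
   elements. *)
Definition encode_sets (l : seq (seq V)) : seq nat :=
  flatten [seq size s :: [seq label x | x <- s] | s <- l].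

(* l lists every member of F exactly once, each as a repetition-free list of
   its elements, in any order. *)
Definition enumeration_of (F : {set {set V}}) (l : seq (seq V)) : Prop :=
  all uniq l /\ perm_eq [seq [set x in s] | s <- l] (enum F).

End Encoding.

(* A word bound polynomial in n, i.e. words of O(log n) bits. *)
Definition word_bound (c n : nat) : nat := n.+1 ^ c.

(* Main.v *)
Require Import Defs.
From mathcomp Require Import all_boot all_order all_algebra.
From mathcomp Require Import reals zify.

(** Call a vertex a one or a zero according to its letter in a creation sequence.
  Ones are pairwise adjacent and zeros pairwise non-adjacent, so the maximal
  independent sets are exactly the sets made of a single one together with all
  later zeros; the ones form a maximum clique, because the only possible zero of a
  clique precedes all its ones and can be exchanged for the first vertex.  A
  threshold graph has a creation sequence since every induced subgraph has a
  dominating or an isolated vertex.  Hence counting amounts to counting the ones,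
  and scanning the sequence backwards while buffering the zeros lists each
  maximal independent set in time proportional to its size plus one. *)

Set Implicit Arguments.
Unset Strict Implicit.
Unset Printing Implicit Defensive.

Import Order.TTheory GRing.Theory Num.Theory.

(** * Creation orders of threshold graphs *)

Section Ranking.
Variables (V : finType) (G : sgraph V).

Lemma independentP (A : {set V}) :
  reflect {in A &, forall x y, ~~ adj G x y} (independent G A).
Proof.
apply: (iffP forall_inP) => [h x y xA yA | h x xA]; first exact: (forall_inP (h x xA)).
by apply/forall_inP => y yA; apply: h.
Qed.

(* [f] gives the position of a vertex in a creation order and [b] its letter. *)
Definition ranking (f : V -> nat) (b : pred V) : Prop :=
  [/\ injective f,
      forall x y, f y < f x -> adj G x y = b x
    & exists2 x0, b x0 & forall y, f x0 <= f y].

(** Apply the threshold condition to the pair of the two vertices: its total weight is at most [T]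
    exactly when the pair is independent, that is, when it is not an edge. *)
Lemma threshold_adj (R : realType) (w : V -> R) (T : R) x y :
  (forall U : {set V}, (\sum_(z in U) w z <= T)%R <-> independent G U) ->
  x != y -> adj G x y = (T < w x + w y)%R.
Proof.
move=> hw xy; have := hw [set x; y]; rewrite big_setU1 ?inE //= big_set1 => hxy.
rewrite ltNge; apply/idP/negP => [a /hxy /independentP/(_ x y) | ].
  by rewrite !inE !eqxx orbT a => /(_ isT isT).
move=> nle; apply/negPn/negP => na; apply/nle/hxy.
apply/independentP => u v; rewrite !inE.
by case/orP => /eqP->; case/orP => /eqP->; rewrite ?adj_irrefl // adj_sym.
Qed.

(* The heaviest vertex dominates if it is adjacent to the lightest remaining
   one; otherwise that lightest one is isolated. *)
Lemma threshold_extremal_vertex (R : realType) (U : {set V}) :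
  threshold_graph R G -> U != set0 ->
  exists u c, u \in U /\ {in U, forall z, z != u -> adj G u z = c}.
Proof.
case=> w [T] [_ _ hw] /set0Pn [x0 x0U].
have adjE x y := @threshold_adj R w T x y hw.
have [x xU xmax] : exists2 x, x \in U & {in U, forall z, (w z <= w x)%R}.
  by case: (@Order.TotalTheory.arg_maxP _ _ _ x0 (mem U) w x0U) => x xU xm; exists x.
have [U1 | [y0 y0P]] := set_0Vmem (U :\ x).
  exists x, true; split=> // z zU zx.
  by have := in_setD1 z U x; rewrite U1 inE zU zx.
have [y yP ymin] : exists2 y, y \in U :\ x & {in U :\ x, forall z, (w y <= w z)%R}.
  by case: (@Order.TotalTheory.arg_minP _ _ _ y0 (mem (U :\ x)) w y0P) => y yU ym; exists y.
have /andP[yx yU] : (y != x) && (y \in U) by rewrite -in_setD1.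
case axy: (adj G x y).
  exists x, true; split=> // z zU zx.
  move: axy; rewrite !adjE 1?eq_sym // => /lt_le_trans; apply.
  by rewrite lerD2l ymin // in_setD1 zx.
exists y, false; split=> // z zU zy; rewrite adjE 1?eq_sym //; apply/negbTE.
move: axy; rewrite adjE 1?eq_sym // => /negbT; rewrite -!leNgt; apply: le_trans.
by rewrite addrC lerD2r xmax.
Qed.

(** Induction on the size of [U]: an extremal vertex [u] is placed last, with its type as letter.
    The bound on ranks is carried along because it makes the rank of [u] new and larger than all the
    others. *)
Lemma threshold_ranking_on (R : realType) (U : {set V}) :
  threshold_graph R G ->
  exists (f : V -> nat) (b : pred V),
    [/\ {in U &, injective f},
        {in U &, forall x y, f y < f x -> adj G x y = b x}
      & {in U, forall x, f x < #|U|}].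
Proof.
move=> thG; have [k] := ubnP #|U|; elim: k U => // k IHk U Uk.
have [-> | U0] := eqVneq U set0.
  by exists (fun=> 0), xpredT; split=> x; rewrite ?inE // => y; rewrite inE.
have [u [c [uU uc]]] := threshold_extremal_vertex thG U0.
have cU : #|U| = #|U :\ u|.+1 by rewrite (cardsD1 u) uU.
have [|f [b [finj fb fU]]] := IHk (U :\ u); first by lia.
have inD x : x \in U -> x != u -> x \in U :\ u by rewrite !inE => -> ->.
exists (fun x => if x == u then #|U :\ u| else f x), (fun x => if x == u then c else b x).
split.
- move=> x y xU yU; case: (eqVneq x u) => [-> | xu]; case: (eqVneq y u) => [-> | yu] //.
  + by have := fU y (inD _ yU yu); lia.
  + by have := fU x (inD _ xU xu); lia.
  + by apply: finj; apply: inD.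
- move=> x y xU yU; case: (eqVneq x u) => [-> | xu]; case: (eqVneq y u) => [-> | yu] //.
  + by rewrite ltnn.
  + by move=> _; apply: uc.
  + by have := fU x (inD _ xU xu); lia.
  + by apply: fb; apply: inD.
- move=> x xU; case: (eqVneq x u) => [_ | xu]; first by lia.
  by have := fU x (inD _ xU xu); lia.
Qed.

Lemma threshold_ranking (R : realType) :
  0 < #|V| -> threshold_graph R G -> exists f b, ranking f b.
Proof.
move=> /card_gt0P [v0 _] thG.
have [f [b [finj fb _]]] := threshold_ranking_on [set: V] thG.
case: (@arg_minnP V v0 xpredT f isT) => x0 _ x0min.
(* No vertex ranks below [x0], so its letter is unconstrained and can be set to one, as the
   convention for the first letter demands. *)
exists f, (fun x => (x == x0) || b x); split.
- by move=> x y; apply: finj; rewrite inE.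
- move=> x y yx; case: eqVneq => [xE | _] /=; last by apply: fb; rewrite ?inE.
  by have := x0min y isT; rewrite -xE; lia.
- by exists x0 => [|y]; rewrite ?eqxx // x0min.
Qed.

(** Ranks are read off with the inverse of [v]; the convention on the first letter provides the one
    of least rank. *)
Lemma creation_ranking n (t : n.-tuple bool) (v : 'I_n -> V) :
  creation_sequence G t v ->
  exists f b, [/\ ranking f b, forall i, f (v i) = i & forall i, b (v i) = tnth t i].
Proof.
case; case=> g vK gK t0 tP.
exists (fun x => g x), (fun x => tnth t (g x)); split; last 2 first.
- by move=> i; rewrite vK.
- by move=> i; rewrite vK.
split.
- by move=> x y /val_inj /(can_inj gK).
- move=> x y yx; have := tP (g x) (leq_ltn_trans (leq0n _) yx).
  by case: (tnth t (g x)) => /(_ _ yx); rewrite !gK // => /negbTE.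
- have n0 : 0 < n by case: n t t0 {v g vK gK tP} => // t; rewrite tuple0.
  by exists (v (Ordinal n0)) => [|y]; rewrite vK // (tnth_nth false).
Qed.

(** * Maximal independent sets and cliques of a ranked graph *)

Section Ranked.
Variables (f : V -> nat) (b : pred V).
Hypothesis fbP : ranking f b.

Definition mis_of (x : V) : {set V} := x |: [set y | ~~ b y & f x < f y].

Lemma ranking_inj : injective f. Proof. by case: fbP. Qed.

Lemma ranking_adj x y : f y < f x -> adj G x y = b x.
Proof. by case: fbP => _ + _; apply. Qed.

Lemma ranking_adj_ones x y : b x -> b y -> x != y -> adj G x y.
Proof.
move=> bx bY xy; case: (ltngtP (f x) (f y)) => [lt | lt | /ranking_inj xE].
- by rewrite adj_sym ranking_adj.
- by rewrite ranking_adj.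
- by rewrite xE eqxx in xy.
Qed.

Lemma ranking_adj_zeros x y : ~~ b x -> ~~ b y -> ~~ adj G x y.
Proof.
move=> bx bY; case: (ltngtP (f x) (f y)) => [lt | lt | /ranking_inj ->].
- by rewrite adj_sym ranking_adj.
- by rewrite ranking_adj.
- by rewrite adj_irrefl.
Qed.

(** [x] is the only one in [mis_of x], so the set determines it. *)
Lemma mis_of_inj : {in b &, injective mis_of}.
Proof.
move=> x y bx bY /setP /(_ x); rewrite !inE eqxx (idP bx : b x = true) /= orbF.
by move/esym/eqP.
Qed.

Lemma mis_of_independent x : independent G (mis_of x).
Proof.
have xz y : ~~ b y -> f x < f y -> ~~ adj G y x by move=> bY xy; rewrite ranking_adj.
apply/independentP => u v; rewrite !inE.
case/predU1P=> [-> | /andP[bu xu]]; case/predU1P=> [-> | /andP[bv xv]].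
- by rewrite adj_irrefl.
- by rewrite adj_sym xz.
- by rewrite xz.
- exact: ranking_adj_zeros.
Qed.

(** A one dominates every earlier vertex and is adjacent to every other one, so its non-neighbours
    are zeros of larger rank. *)
Lemma independent_sub_mis_of (A : {set V}) x :
  b x -> x \in A -> independent G A -> A \subset mis_of x.
Proof.
move=> bx xA /independentP iA; apply/subsetP => y yA; rewrite !inE.
case: eqVneq => //= yx; have naxy := iA x y xA yA.
have bY : ~~ b y by apply: contraNN naxy => bY; rewrite ranking_adj_ones // eq_sym.
rewrite bY /=; case: ltngtP => // [lt | /ranking_inj xE].
  by rewrite ranking_adj ?bx in naxy.
by rewrite xE eqxx in yx.
Qed.

Lemma max_indep_setsE : max_indep_sets G = [set mis_of x | x in b].
Proof.
have [_ _ [x0 bx0 x0min]] := fbP.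
apply/setP => A; rewrite inE; apply/maxsetP/imsetP => [[iA Amax] | [x bx ->]].
  have [x xP | noone] := pickP [pred x in A | b x].
    case/andP: xP => xA bx; exists x => //; apply/esym/Amax.
      exact: mis_of_independent.
    exact: independent_sub_mis_of.
  (* Here [A] has only zeros. They all come after the first vertex [x0], so [A] lies in [mis_of x0]
     and maximality gives equality. *)
  exists x0 => //; apply/esym/Amax; first exact: mis_of_independent.
  apply/subsetP => y yA; rewrite !inE; have := noone y; rewrite /= yA /= => by0.
  rewrite by0 /= ltn_neqAle x0min andbT orbC; apply/orP; left.
  by apply: contraFN by0 => /eqP/ranking_inj <-.
split=> [|B iB sB]; first exact: mis_of_independent.
apply/eqP; rewrite eqEsubset sB andbT independent_sub_mis_of //.
by apply: (subsetP sB); rewrite !inE eqxx.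
Qed.

Lemma card_max_indep_sets_ranking : #|max_indep_sets G| = #|b|.
Proof. by rewrite max_indep_setsE card_in_imset //; apply: mis_of_inj. Qed.

(* A clique has at most one zero, and it is then placed before all its ones, so
   its ones miss the one of least rank. *)
Lemma omega_ranking : omega G = #|b|.
Proof.
have [_ _ [x0 bx0 x0min]] := fbP.
apply/eqP; rewrite eqn_leq; apply/andP; split; last first.
  rewrite -(cardsE b); apply: leq_bigmax_cond.
  apply/forall_inP => x; rewrite inE => bx; apply/forall_inP => y; rewrite inE => bY.
  by apply/implyP => xy; apply: ranking_adj_ones.
apply/bigmax_leqP => K /forall_inP cK.
have {}cK x y : x \in K -> y \in K -> x != y -> adj G x y.
  by move=> xK yK; apply/implyP; apply: (forall_inP (cK x xK)).
have [z /andP[zK bz] | nozero] := pickP [pred z in K | ~~ b z]; last first.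
  apply/subset_leq_card/subsetP => x xK; apply/negPn/negP => bx.
  by have := nozero x; rewrite /= xK bx.
have ones x : x \in K -> x != z -> b x /\ f z < f x.
  move=> xK xz; have a := cK _ _ xK zK xz.
  have bx : b x by apply: contraTT a => bx; apply: ranking_adj_zeros.
  split=> //; case: ltngtP => // [lt | /ranking_inj zx]; last by rewrite zx eqxx in xz.
  by move: a; rewrite adj_sym ranking_adj // (negbTE bz).
rewrite (cardsD1 z) zK (cardD1 x0 b) unfold_in bx0 !add1n ltnS.
apply/subset_leq_card/subsetP => x; rewrite !inE => /andP[xz xK].
have [bx zx] := ones x xK xz; rewrite unfold_in bx andbT.
by apply: contraTneq zx => ->; rewrite -leqNgt.
Qed.

End Ranked.
End Ranking.

(** * Time-bounded program logic for the machine *)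

Section Runs.
Variables (W : nat) (p : program).

(** A total-correctness triple with a time budget. Since [T] is only an upper bound, budgets can be
    rounded up and added under sequencing. *)
Definition runs (T : nat) (s : state) (Q : state -> Prop) : Prop :=
  exists k s', [/\ k <= T, steps W p k s = Some s' & Q s'].

Lemma runs_ret T s (Q : state -> Prop) : Q s -> runs T s Q.
Proof. by move=> Qs; exists 0, s. Qed.

Lemma runs_step T s s1 Q : step W p s = Some s1 -> runs T s1 Q -> runs T.+1 s Q.
Proof.
move=> s1E [k [s' [kT sE Qs']]]; exists k.+1, s'; split=> //.
by rewrite /steps iterSr /= s1E.
Qed.

Lemma runs_le T T' s Q : T <= T' -> runs T s Q -> runs T' s Q.
Proof. by move=> TT' [k [s' [kT sE Qs']]]; exists k, s'; split=> //; apply: leq_trans TT'. Qed.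

Lemma runs_bind T1 T2 s (Q1 Q2 : state -> Prop) :
  runs T1 s Q1 -> (forall s', Q1 s' -> runs T2 s' Q2) -> runs (T1 + T2) s Q2.
Proof.
move=> [k1 [s1 [kT1 s1E /[swap] + Q1s]]] => /(_ _ Q1s) [k2 [s2 [kT2 s2E Q2s]]].
exists (k2 + k1), s2; split=> //; first by rewrite addnC leq_add.
by rewrite /steps iterD -/(steps W p k1 s) s1E.
Qed.

Definition upd (m : nat -> nat) (a x : nat) : nat -> nat :=
  fun b => if b == a then x else m b.

Lemma updE m a x b : upd m a x b = if b == a then x else m b.
Proof. by []. Qed.

Section Instructions.
Variables (T q : nat) (m : nat -> nat) (i o : seq nat) (Q : state -> Prop).

(** This and the following rules execute one instruction symbolically at the cost of one unit of
    budget; a premise [< W] excludes the overflow fault of an instruction that writes. *)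
Lemma runs_const a x : nth IHalt p q = IConst a x -> x < W ->
  runs T (State q.+1 (upd m a x) i o) Q -> runs T.+1 (State q m i o) Q.
Proof. by move=> pE lt; apply: runs_step; rewrite /step /fetch /= pE /write lt. Qed.

Lemma runs_add a j k : nth IHalt p q = IAdd a j k -> m j + m k < W ->
  runs T (State q.+1 (upd m a (m j + m k)) i o) Q -> runs T.+1 (State q m i o) Q.
Proof. by move=> pE lt; apply: runs_step; rewrite /step /fetch /= pE /write lt. Qed.

Lemma runs_sub a j k : nth IHalt p q = ISub a j k -> m j - m k < W ->
  runs T (State q.+1 (upd m a (m j - m k)) i o) Q -> runs T.+1 (State q m i o) Q.
Proof. by move=> pE lt; apply: runs_step; rewrite /step /fetch /= pE /write lt. Qed.

Lemma runs_get a j : nth IHalt p q = IGet a j -> m (m j) < W ->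
  runs T (State q.+1 (upd m a (m (m j))) i o) Q -> runs T.+1 (State q m i o) Q.
Proof. by move=> pE lt; apply: runs_step; rewrite /step /fetch /= pE /write lt. Qed.

Lemma runs_put a j : nth IHalt p q = IPut a j -> m j < W ->
  runs T (State q.+1 (upd m (m a) (m j)) i o) Q -> runs T.+1 (State q m i o) Q.
Proof. by move=> pE lt; apply: runs_step; rewrite /step /fetch /= pE /write lt. Qed.

Lemma runs_jump j r : nth IHalt p q = IJpos j r -> 0 < m j ->
  runs T (State r m i o) Q -> runs T.+1 (State q m i o) Q.
Proof. by move=> pE lt; apply: runs_step; rewrite /step /fetch /= pE lt. Qed.

Lemma runs_nojump j r : nth IHalt p q = IJpos j r -> m j = 0 ->
  runs T (State q.+1 m i o) Q -> runs T.+1 (State q m i o) Q.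
Proof. by move=> pE m0; apply: runs_step; rewrite /step /fetch /= pE m0. Qed.

Lemma runs_read a x : nth IHalt p q = IRead a -> x < W ->
  runs T (State q.+1 (upd m a x) i o) Q -> runs T.+1 (State q m (x :: i) o) Q.
Proof. by move=> pE lt; apply: runs_step; rewrite /step /fetch /= pE /write lt. Qed.

Lemma runs_print j : nth IHalt p q = IPrint j ->
  runs T (State q.+1 m i (rcons o (m j))) Q -> runs T.+1 (State q m i o) Q.
Proof. by move=> pE; apply: runs_step; rewrite /step /fetch /= pE. Qed.

End Instructions.

Lemma runs_computes T input output :
  runs T (initial input) (fun s => halted p s /\ out s = output) ->
  computes_within W p T input output.
Proof. by case=> k [s [kT sE [hs oE]]]; exists k, s. Qed.

End Runs.

(** * Counting in linear time *)

(** Register 0 holds the number of letters left, 1 the constant 1, 2 the current letter and 3 the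
    sum, which relies on the memory being initially zero. The labels stay unread on the tape. *)
Definition count_program : program :=
  [:: IRead 0;
      IConst 1 1;
      (* 2 *) IRead 2;
      IAdd 3 3 2;
      ISub 0 0 1;
      IJpos 0 2;
      IPrint 3;
      IHalt].

(** Each letter costs four instructions. The exit test is at the bottom of the loop, so [l] must be
    nonempty; register 3 is left arbitrary to serve as accumulator in the induction. *)
Lemma count_loop W (l : seq bool) rest o m :
  0 < size l -> 1 < W -> m 0 = size l -> m 1 = 1 -> size l < W -> m 3 + count id l < W ->
  runs W count_program (4 * size l) (State 2 m (map nat_of_bool l ++ rest) o)
    (fun s => [/\ pc s = 6, Defs.mem s 3 = m 3 + count id l & out s = o]).
Proof.
elim: l m => // c l IHl m _ W1 m0 m1 lW cW; rewrite /= in m0 lW cW *.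
have -> : 4 * (size l).+1 = (4 * size l).+4 by lia.
apply: runs_read; [by [] | by case: (c); lia |].
apply: runs_add; [by [] | rewrite /upd /=; lia |].
apply: runs_sub; [by [] | rewrite /upd /=; lia |].
case: l IHl m0 lW cW => [|c' l] IHl m0 lW cW.
  apply: runs_nojump; [by [] | by rewrite /upd /= m0 m1 |].
  by apply: runs_ret; split; rewrite //= /upd /=; lia.
apply: runs_jump; [by [] | rewrite /upd /= m0 m1 /=; lia |].
set m' := upd _ 0 _.
have [m'0 m'1 m'3] : [/\ m' 0 = size (c' :: l), m' 1 = 1 & m' 3 = m 3 + c].
  by rewrite /m' /upd /= m0 m1; split=> //; lia.
have [//|//|//|//| | |k [s [kT sE [pE m3E oE]]]] := IHl m'.
- by move: lW => /=; lia.
- by rewrite m'3 -addnA.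
by exists k, s; split=> //; split=> //; rewrite m3E m'3 -addnA.
Qed.

Lemma count_program_correct W (l : seq bool) rest :
  0 < size l -> size l < W ->
  computes_within W count_program (7 * size l)
    (size l :: map nat_of_bool l ++ rest) [:: count id l].
Proof.
move=> l0 lW; apply: runs_computes.
(* Two instructions before the loop and one print after it: [4 * size l + 3] is at most [7 * size l]
   as [l] is nonempty. *)
apply: (@runs_le _ _ (4 * size l + 1).+2); first by lia.
apply: runs_read; [by [] | by [] |].
apply: runs_const; [by [] | by lia |].
apply: runs_bind; first apply: count_loop; rewrite ?updE //=; try lia.
  by have := count_size id l; lia.
case=> [q m i o] /= [-> m3 ->].
by apply: runs_print => //; apply: runs_ret; split; rewrite //= m3.
Qed.

(** * Enumeration program and its loops *)

(* Layout: 0 = remaining vertices, 1 = the constant 1, 2 = base of the buffer of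
   zeros, 5 / 6 = pointers into the labels / letters, 7 / 8 = end / length of the
   buffer, 10 = the constant 0; the letters start at address 16, followed by the
   labels, followed by the buffer. *)
Definition enum_program : program :=
  [:: IRead 0;
      IConst 1 1;
      IConst 2 16;
      IAdd 4 0 0;
      (* 4: read letters and labels *)
      IRead 3;
      IPut 2 3;
      IAdd 2 2 1;
      ISub 4 4 1;
      IJpos 4 4;
      IAdd 5 2 10;
      IAdd 7 2 10;
      ISub 6 2 0;
      (* 12: next vertex, from the last to the first *)
      ISub 5 5 1;
      ISub 6 6 1;
      IGet 3 5;
      IGet 4 6;
      IJpos 4 21;
      (* 17: a zero is appended to the buffer *)
      IPut 7 3;
      IAdd 7 7 1;
      IAdd 8 8 1;
      IJpos 1 33;
      (* 21: a one is printed with the buffer *)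
      IAdd 4 8 1;
      IPrint 4;
      IPrint 3;
      IAdd 9 8 10;
      IAdd 4 2 10;
      (* 26: print the buffer *)
      IJpos 9 28;
      IJpos 1 33;
      IGet 3 4;
      IPrint 3;
      IAdd 4 4 1;
      ISub 9 9 1;
      IJpos 1 26;
      (* 33 *)
      ISub 0 0 1;
      IJpos 0 12;
      IHalt].

(** Here [j] words have already been stored and register 2 points to the next free cell. The last
    clause, on untouched cells, protects in the induction the word that was just stored. *)
Lemma read_loop W (l : seq nat) o j m :
  0 < size l -> all (ltn^~ W) l -> 16 + j + size l < W ->
  m 1 = 1 -> m 2 = 16 + j -> m 4 = size l ->
  runs W enum_program (5 * size l) (State 4 m l o)
    (fun s => [/\ pc s = 9, out s = o, Defs.mem s 2 = 16 + j + size l,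
       forall i, i < size l -> Defs.mem s (16 + j + i) = nth 0 l i
     & forall a, a < 16 + j -> a \notin [:: 2; 3; 4] -> Defs.mem s a = m a]).
Proof.
elim: l j m => // x l IHl j m _ /= /andP[xW lW] jW m1 m2 m4.
have -> : 5 * (size l).+1 = (5 * size l).+4.+1 by lia.
apply: runs_read; [by [] | by [] |].
apply: runs_put; [by [] | by rewrite /upd /= |].
rewrite !updE /= m2; set m' := upd _ _ _.
have m'E a : a != 3 -> a != 16 + j -> m' a = m a.
  by rewrite /m' !updE => /negbTE-> /negbTE->.
have [m'1 m'2 m'4] : [/\ m' 1 = 1, m' 2 = 16 + j & m' 4 = (size l).+1].
  by rewrite !m'E //; lia.
have m'j : m' (16 + j) = x by rewrite /m' updE eqxx.
apply: runs_add; [by [] | by lia |].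
apply: runs_sub; [by [] | by rewrite !updE /= ; lia |].
set m2' := upd _ 4 _.
have m2'E a : a != 2 -> a != 4 -> m2' a = m' a.
  by rewrite /m2' !updE => /negbTE-> /negbTE->.
have [m2'1 m2'2 m2'4] : [/\ m2' 1 = 1, m2' 2 = 16 + j.+1 & m2' 4 = size l].
  by rewrite /m2' !updE /=; split; lia.
case: l IHl lW jW m2'4 {m'4} m4 => [|y l] IHl lW jW m2'4 m4.
  apply: runs_nojump => //; apply: runs_ret; split=> //=.
  - by rewrite m2'2; lia.
  - by case=> // _; rewrite addn0 m2'E ?m'j //; lia.
  - by move=> a aj; rewrite !inE !negb_or => /and3P[a2 a3 a4]; rewrite m2'E // m'E //; lia.
apply: runs_jump; [by [] | by rewrite m2'4 |].
have [|//|//|//|//|//|k [s [kT sE [pE oE s2 sj sa]]]] := IHl j.+1 m2'; first by [].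
  by move: jW => /=; lia.
exists k, s; split=> //; split=> //.
- by rewrite s2 /=; lia.
- case=> [|i] iP.
    by rewrite sa ?m2'E ?addn0 ?m'j //= ?inE; lia.
  have -> : 16 + j + i.+1 = 16 + j.+1 + i by lia.
  by rewrite sj.
- move=> a aj aP; rewrite sa //; last by lia.
  move: aP; rewrite !inE !negb_or => /and3P[a2 a3 a4].
  by rewrite m2'E // m'E //; lia.
Qed.

(** Six instructions per word and two to leave. The test is at the top, so an empty buffer is
    allowed; [9 < q] keeps the buffer away from the scratch registers 3, 4 and 9. As register 1
    holds 1, [IJpos 1] is an unconditional jump. *)
Lemma print_loop W (z : seq nat) i o q m :
  all (ltn^~ W) z -> q + size z < W -> m 1 = 1 -> m 4 = q -> m 9 = size z ->
  9 < q ->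
  (forall k, k < size z -> m (q + k) = nth 0 z k) ->
  runs W enum_program (6 * size z + 2) (State 26 m i o)
    (fun s => [/\ pc s = 33, out s = o ++ z
     & forall a, a \notin [:: 3; 4; 9] -> Defs.mem s a = m a]).
Proof.
elim: z q o m => [|x z IHz] q o m /= => [_ _ m1 m4 m9 q9 _|/andP[xW zW] qW m1 m4 m9 q9 mz].
  apply: runs_nojump => //; apply: runs_jump; rewrite ?m1 //.
  by apply: runs_ret; split; rewrite ?cats0.
have -> : 6 * (size z).+1 + 2 = (6 * size z + 2).+4.+2 by lia.
have mq : m q = x by rewrite -[q in m q]addn0 (mz 0).
apply: runs_jump; [by [] | by rewrite m9 |].
apply: runs_get; [by [] | by rewrite m4 mq |].
apply: runs_print; first by [].
rewrite updE /= m4 mq.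
apply: runs_add; [by [] | by rewrite !updE /=; lia |].
apply: runs_sub; [by [] | by rewrite !updE /=; lia |].
apply: runs_jump; [by [] | by rewrite !updE /= m1 |].
set m' := upd _ 9 _.
have m'E a : a \notin [:: 3; 4; 9] -> m' a = m a.
  by rewrite /m' !inE !negb_or !updE => /and3P[/negbTE-> /negbTE-> /negbTE->].
have [m'4 m'9] : m' 4 = q.+1 /\ m' 9 = size z.
  by rewrite /m' !updE /=; lia.
have [//||||//|||k [s [kT sE [pE oE sa]]]] := IHz q.+1 (rcons o x) m'.
- by lia.
- by rewrite m'E.
- by [].
- by lia.
-  move=> k kz; rewrite m'E ?inE; last by lia.
  by rewrite addSnnS mz.
exists k, s; split=> //; split=> //; first by rewrite oE cat_rcons.
by move=> a aP; rewrite sa // m'E.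
Qed.

(* Scans a vertex list from the last to the first vertex of the creation order;
   [z] collects the zeros met so far. *)
Fixpoint mis_lists (T : Type) (b : pred T) (l z : seq T) : seq (seq T) :=
  if l is x :: l' then
    if b x then (x :: z) :: mis_lists b l' z else mis_lists b l' (rcons z x)
  else [::].

Section EnumLoop.
Variables (V : finType) (b : pred V) (W n : nat).
Hypotheses (labelW : forall x : V, label x < W) (nW : 16 + 3 * n + 2 < W).

Let zb := 16 + n + n.

(** The vertices still to be treated form [l], last one first, so memory holds the letters and
    labels of [rev l]. Each vertex costs at most 11 instructions, plus at most [6 * n + 5] for a
    one, because the buffer never has more than [n] labels. *)
Lemma enum_loop (l z : seq V) i o m :
  0 < size l -> size l + size z <= n ->
  m 0 = size l -> m 1 = 1 -> m 2 = zb -> m 5 = 16 + n + size l ->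
  m 6 = 16 + size l -> m 7 = zb + size z -> m 8 = size z -> m 10 = 0 ->
  (forall k, k < size l -> m (16 + k) = nth 0 [seq nat_of_bool (b x) | x <- rev l] k) ->
  (forall k, k < size l -> m (16 + n + k) = nth 0 [seq label x | x <- rev l] k) ->
  (forall k, k < size z -> m (zb + k) = nth 0 [seq label x | x <- z] k) ->
  runs W enum_program (11 * size l + count b l * (6 * n + 5)) (State 12 m i o)
    (fun s => halted enum_program s /\ out s = o ++ encode_sets (mis_lists b l z)).
Proof.
rewrite /zb; elim: l z i o m => // x l IHl z i o m _ /= ln m0 m1 m2 m5 m6 m7 m8 m10 mb ml mz.
have rl : size (rev l) = size l by rewrite size_rev.
have mbx : m (16 + size l) = b x.
  by rewrite mb // rev_cons map_rcons nth_rcons size_map rl ltnn eqxx.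
have mlx : m (16 + n + size l) = label x.
  by rewrite ml // rev_cons map_rcons nth_rcons size_map rl ltnn eqxx.
have {}mb k : k < size l -> m (16 + k) = nth 0 [seq nat_of_bool (b y) | y <- rev l] k.
  by move=> kl; rewrite mb; [rewrite rev_cons map_rcons nth_rcons size_map rl kl | lia].
have {}ml k : k < size l -> m (16 + n + k) = nth 0 [seq label y | y <- rev l] k.
  by move=> kl; rewrite ml; [rewrite rev_cons map_rcons nth_rcons size_map rl kl | lia].
set B := (X in runs _ _ X).
(* The budget is split into 4 instructions to fetch label and letter, [5 + c] to treat the vertex, 2
   for the loop test, and the rest for the remaining vertices. *)
pose c := if b x then 6 * n + 5 else 0.
have {B} -> : B = (4 + ((5 + c) + (2 + (11 * size l + count b l * (6 * n + 5))))).
  by rewrite /B /c; case: (b x) => /=; lia.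
apply: runs_sub; [by [] | by lia |].
apply: runs_sub; [by [] | by rewrite !updE /=; lia |].
rewrite !updE /= m5 m6 m1.
have -> : 16 + n + (size l).+1 - 1 = 16 + n + size l by lia.
have -> : 16 + (size l).+1 - 1 = 16 + size l by lia.
set m' := upd _ 6 _.
have m'E a : a != 5 -> a != 6 -> m' a = m a.
  by rewrite /m' !updE => /negbTE-> /negbTE->.
have [m'5 m'6] : m' 5 = 16 + n + size l /\ m' 6 = 16 + size l by [].
apply: runs_get; [by [] | by rewrite m'5 m'E ?mlx //; lia |].
have -> : m' (m' 5) = label x by rewrite m'5 m'E ?mlx //; lia.
have bitx : upd m' 3 (label x) (upd m' 3 (label x) 6) = b x.
  have -> : upd m' 3 (label x) 6 = 16 + size l by [].
  by rewrite updE m'E ?mbx //; lia.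
apply: runs_get; [by [] | by rewrite bitx; case: (b x); lia |].
rewrite bitx.
set m2' := upd _ 4 _.
have m2'E a : a \notin [:: 3; 4; 5; 6] -> m2' a = m a.
  rewrite !inE !negb_or => /and4P[a3 a4 a5 a6].
  by rewrite /m2' !updE (negbTE a3) (negbTE a4) m'E.
have [m2'3 m2'4 m2'5 m2'6] :
  [/\ m2' 3 = label x, m2' 4 = b x, m2' 5 = 16 + n + size l & m2' 6 = 16 + size l] by [].
pose z' := if b x then z else rcons z x.
pose o' := if b x then o ++ encode_sets [:: x :: z] else o.
have encE : o ++ encode_sets (if b x then (x :: z) :: mis_lists b l z
    else mis_lists b l (rcons z x)) = o' ++ encode_sets (mis_lists b l z').
  by rewrite /o' /z'; case: (b x); rewrite // /encode_sets /= cats0 -!catA.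
rewrite encE.
(* Both branches meet at instruction 33, with buffer [z'] and output [o']; below the buffer only
   scratch registers and the two buffer registers 7 and 8 may have changed. *)
apply: (@runs_bind _ _ _ _ _ (fun s => [/\ pc s = 33 /\ out s = o',
    Defs.mem s 7 = zb + size z', Defs.mem s 8 = size z',
    forall k, k < size z' -> Defs.mem s (zb + k) = nth 0 [seq label y | y <- z'] k
  & forall a, a < zb -> a \notin [:: 3; 4; 7; 8; 9] -> Defs.mem s a = m2' a])).
  rewrite /o' /z' /c; case bx : (b x); rewrite bx in m2'4.
    apply: (@runs_le _ _ (6 * n + 2).+4.+2); first by lia.
    apply: runs_jump; [by [] | by rewrite m2'4 |].
    apply: runs_add; [by [] | by rewrite !m2'E //; lia |].
    apply: runs_print; first by [].
    apply: runs_print; first by [].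
    apply: runs_add; [by [] | by rewrite !updE /= !m2'E //; lia |].
    apply: runs_add; [by [] | by rewrite !updE /= !m2'E //; lia |].
    set m3 := upd _ 4 _.
    have m3E a : a \notin [:: 4; 9] -> m3 a = m2' a.
      by rewrite /m3 !inE !negb_or !updE => /andP[/negbTE-> /negbTE->].
    have [m34 m39] : m3 4 = zb /\ m3 9 = size z.
      by rewrite /m3 !updE /= !m2'E // m10 m2 m8; split; lia.
    have m3a a : 9 < a -> m3 a = m2' a by move=> a9; rewrite m3E // !inE; lia.
    have m2'a a : 9 < a -> m2' a = m a by move=> a9; rewrite m2'E // !inE; lia.
    have [||||||| k [s [kT sE [pE oE sa]]]] :=
      @print_loop W [seq label y | y <- z] i
        (rcons (rcons o (upd m2' 4 (m2' 8 + m2' 1) 4)) (upd m2' 4 (m2' 8 + m2' 1) 3)) zb m3.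
    - by rewrite all_map; apply/allP => y _ /=.
    - by rewrite size_map /zb; lia.
    - by rewrite m3E // m2'E.
    - by [].
    - by rewrite size_map.
    - by rewrite /zb; lia.
    - by move=> k; rewrite size_map => kz; rewrite m3a ?m2'a ?mz //; rewrite /zb; lia.
    exists k, s; split=> //.
      by apply: leq_trans kT _; rewrite size_map; lia.
    split=> //.
    - split=> //; rewrite oE !updE /= m2'3 !m2'E // m8 m1 addn1 !cat_rcons.
      by rewrite /encode_sets /= cats0.
    - by rewrite sa // m3E // m2'E.
    - by rewrite sa // m3E // m2'E.
    - by move=> k' kz; rewrite sa ?m3a ?m2'a ?mz ?inE //; rewrite /zb; lia.
    - move=> a azb; rewrite !inE !negb_or => /and5P[a3 a4 a7 a8 a9].
      by rewrite sa ?m3E ?inE ?negb_or ?a3 ?a4 ?a9.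
  (* The letter is zero: the label goes to the first free buffer cell, which lies above all
     registers and stored input. *)
  apply: runs_nojump => //.
  apply: runs_put; [by [] | by rewrite m2'3 |].
  rewrite m2'3 m2'E // m7; set m3 := upd _ _ _.
  have m3E a : a != zb + size z -> m3 a = m2' a by rewrite /m3 updE => /negbTE->.
  have m3r a : a < 16 -> m3 a = m2' a by move=> a16; rewrite m3E // /zb; lia.
  apply: runs_add; [by [] | by rewrite !m3r // !m2'E //; lia |].
  apply: runs_add; [by [] | by rewrite !updE /= !m3r // !m2'E //; lia |].
  apply: runs_jump; [by [] | by rewrite !updE /= m3r // m2'E // m1 |].
  rewrite !updE /= !m3r // !m2'E // m7 m8 m1.
  have ua a x7 x8 : a != 7 -> a != 8 -> upd (upd m3 7 x7) 8 x8 a = m3 a.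
    by rewrite !updE => /negbTE-> /negbTE->.
  apply: runs_ret; split=> //=.
  - by rewrite !updE /= size_rcons /zb; lia.
  - by rewrite !updE /= size_rcons; lia.
  - move=> k; rewrite size_rcons ltnS leq_eqVlt map_rcons nth_rcons size_map.
    case/predU1P=> [-> | kz]; rewrite ua; try by rewrite /zb; lia.
      by rewrite /m3 updE eqxx ltnn eqxx.
    by rewrite kz m3E ?m2'E ?mz ?inE //; rewrite /zb; lia.
  - move=> a azb; rewrite !inE !negb_or => /and5P[a3 a4 a7 a8 a9].
    by rewrite ua // m3E //; rewrite /zb in azb *; lia.
case=> [q ms i' os] /= [[-> ->] {os} ms7 ms8 msz msa].
have msr a : a < zb -> a \notin [:: 3; 4; 5; 6; 7; 8; 9] -> ms a = m a.
  move=> azb; rewrite !inE !negb_or => /and5P[a3 a4 a5 a6 /and3P[a7 a8 a9]].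
  by rewrite msa ?m2'E ?inE ?negb_or ?a3 ?a4 ?a5 ?a6 ?a7 ?a8 ?a9.
have zb16 : 16 <= zb by rewrite /zb; lia.
have [ms0 ms1] : ms 0 = (size l).+1 /\ ms 1 = 1.
  by rewrite !msr //; lia.
have z'n : size l + size z' <= n.
  by move: ln; rewrite /z'; case: (b x); rewrite ?size_rcons; lia.
apply: runs_sub; [by [] | by lia |].
rewrite ms0 ms1 subn1 /=; set m4 := upd _ 0 _.
have m4E a : a != 0 -> m4 a = ms a by rewrite /m4 updE => /negbTE->.
have m40 : m4 0 = size l by [].
have m4r a : a < zb -> a \notin [:: 0; 3; 4; 5; 6; 7; 8; 9] -> m4 a = m a.
  by move=> azb; rewrite inE negb_or => /andP[a0 aP]; rewrite m4E // msr.
have m4l a : 9 < a -> a < zb -> m4 a = m a.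
  by move=> a9 azb; rewrite m4r // !inE; lia.
have [l0 | l0] := posnP (size l).
  apply: runs_nojump; [by [] | by rewrite m40 |].
  by apply: runs_ret; rewrite (size0nil l0) /= cats0.
apply: runs_jump; [by [] | by rewrite m40 |].
apply: IHl => //.
- by rewrite m4r //; lia.
- by rewrite m4E // msa //; lia.
- by rewrite m4E // msa //; lia.
- by rewrite m4l //; lia.
- by move=> k kl; rewrite m4l ?mb //; rewrite /zb; lia.
- by move=> k kl; rewrite m4l ?ml //; rewrite /zb; lia.
Qed.

End EnumLoop.

Lemma enum_program_correct (V : finType) (b : pred V) W (r : seq V) :
  0 < size r -> (forall x : V, label x < W) -> 16 + 3 * size r + 2 < W ->
  computes_within W enum_program (28 * size r + count b r * (6 * size r + 5))
    (size r :: [seq nat_of_bool (b x) | x <- r] ++ [seq label x | x <- r])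
    (encode_sets (mis_lists b (rev r) [::])).
Proof.
move=> r0 labelW rW; apply: runs_computes.
pose n := size r; rewrite -/n in r0 rW *.
(* Letters and labels are read as one block of [2 * n] words, so the labels start at address
   [16 + n]. *)
set inl := (X in n :: X).
have sz : size inl = n + n by rewrite /inl size_cat !size_map.
(* Reading takes [10 * n] steps and the seven instructions around it are charged to [7 * n], which
   together with [11 * n] gives [28 * n]. *)
apply: (@runs_le _ _ (5 * size inl + (11 * n + count b r * (6 * n + 5)).+3).+4).
  by rewrite sz; lia.
apply: runs_read; [by [] | by lia |].
apply: runs_const; [by [] | by lia |].
apply: runs_const; [by [] | by lia |].
apply: runs_add; [by [] | by rewrite !updE /=; lia |].
rewrite !updE /=; set m := upd _ 4 _.
have m4 : m 4 = size inl by rewrite sz.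
apply: runs_bind; first apply: (@read_loop _ _ _ 0) => //.
- by rewrite sz; lia.
- rewrite all_cat !all_map; apply/andP; split; apply/allP => x _ //=.
  by case: (b x); lia.
- by rewrite sz; lia.
case=> [q ms i o] /= [-> -> ms2 msl msa].
(* Registers 8 and 10 still have their initial value 0: the buffer is empty and the constant 0 is
   available for copying. *)
have [ms0 ms1 ms8 ms10] : [/\ ms 0 = n, ms 1 = 1, ms 8 = 0 & ms 10 = 0].
  by split; rewrite msa.
rewrite addn0 sz in ms2; rewrite addn0 sz in msl.
apply: runs_add; [by [] | by lia |].
apply: runs_add; [by [] | by rewrite !updE /=; lia |].
apply: runs_sub; [by [] | by rewrite !updE /=; lia |].
rewrite !updE /= ms0 ms2 ms10 addn0.
set m' := upd _ 6 _.
have m'E a : a \notin [:: 5; 6; 7] -> m' a = ms a.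
  by rewrite !inE !negb_or /m' !updE => /and3P[/negbTE-> /negbTE-> /negbTE->].
have m'l a : 9 < a -> m' a = ms a by move=> a9; rewrite m'E // !inE; lia.
have -> : 11 * n + count b r * (6 * n + 5) =
    11 * size (rev r) + count b (rev r) * (6 * n + 5) by rewrite size_rev count_rev.
apply: (@enum_loop V b W n labelW _ (rev r) [::] i [::] m'); rewrite ?size_rev ?revK //=.
- by lia.
- by rewrite /m' !updE /=; lia.
- by rewrite /m' !updE /=; lia.
- move=> k kr; rewrite m'l ?msl /inl; try lia.
  by rewrite nth_cat size_map kr.
- move=> k kr; rewrite m'l -?addnA ?msl /inl; try lia.
  by rewrite nth_cat size_map ltnNge leq_addr /= addKn.
Qed.

(** * From scanned lists to maximal independent sets *)

(** Along decreasing ranks, the zeros of [l] met before [x] are exactly those of larger rank; [z]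
    holds the zeros buffered before [l] is scanned. *)
Lemma mis_listsE (T : eqType) (f : T -> nat) (b : pred T) (l z : seq T) :
  sorted (fun x y => f y < f x) l ->
  mis_lists b l z =
  [seq x :: z ++ [seq y <- l | ~~ b y & f x < f y] | x <- l & b x].
Proof.
elim: l z => //= x l IHl z.
rewrite path_sortedE; last by move=> u v w /= vu wv; apply: ltn_trans vu.
case/andP=> /allP /= xl ls.
have nil : [seq y <- l | ~~ b y & f x < f y] = [::].
  apply/eqP; rewrite -(negbK (_ == _)) -has_filter; apply/hasPn => y /xl /=.
  by move=> yx; rewrite negb_and -leqNgt (ltnW yx) orbT.
case bx: (b x) => /=; first by rewrite nil cats0 IHl.
rewrite IHl //; apply/eq_in_map => y; rewrite mem_filter => /andP[_ yl].
by rewrite xl //= cat_rcons.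
Qed.

(** Strictly decreasing ranks make [l] duplicate-free, each one [x] yields a list of [mis_of x], and
    injectivity of [mis_of] on ones rules out repeated sets. *)
Lemma enumeration_mis_lists (V : finType) (G : sgraph V) (f : V -> nat) (b : pred V)
    (l : seq V) :
  ranking G f b -> (forall x, x \in l) -> sorted (fun x y => f y < f x) l ->
  enumeration_of (max_indep_sets G) (mis_lists b l [::]).
Proof.
move=> fbP memT ls.
have ul : uniq l.
  by apply: sorted_uniq ls => [u v w /= vu wv | u /=]; [apply: ltn_trans vu | apply: ltnn].
rewrite /enumeration_of (mis_listsE _ _ ls); split.
  apply/allP => _ /mapP[x _ ->] /=.
  by rewrite mem_filter ltnn andbF filter_uniq.
rewrite -map_comp; set S := (S in map S).
have -> : map S [seq x <- l | b x] = map (mis_of f b) [seq x <- l | b x].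
  by apply: eq_map => x; apply/setP => y; rewrite /S !inE mem_filter memT andbT.
apply: uniq_perm; last 1 first.
- move=> A; rewrite mem_enum (max_indep_setsE fbP).
  apply/mapP/imsetP => [[x] | [x bx ->]]; last by exists x; rewrite ?mem_filter ?memT ?andbT.
  by rewrite mem_filter => /andP[bx _] ->; exists x.
- rewrite map_inj_in_uniq ?filter_uniq // => x y.
  by rewrite !mem_filter => /andP[bx _] /andP[bY _]; apply: mis_of_inj.
- exact: enum_uniq.
Qed.

Lemma sorted_enum_creation n (V : finType) (v : 'I_n -> V) (f : V -> nat) :
  (forall i, f (v i) = i) ->
  sorted (fun x y => f y < f x) (rev [seq v i | i <- enum 'I_n]).
Proof.
move=> fv; rewrite rev_sorted sorted_map.
rewrite (@eq_sorted _ _ (relpre val ltn)); last by move=> i j /=; rewrite !fv.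
by rewrite -sorted_map val_enum_ord iota_ltn_sorted.
Qed.

(** Links the input encoding to the ranking: it gathers what both programs need about the vertex
    list [r] in creation order. *)
Lemma creation_lists (V : finType) (G : sgraph V) n (t : n.-tuple bool) (v : 'I_n -> V) :
  creation_sequence G t v ->
  exists f b, let r := [seq v i | i <- enum 'I_n] in
    [/\ ranking G f b, forall x, x \in r, sorted (fun x y => f y < f x) (rev r),
        0 < n /\ #|V| = n
      & val t = [seq b x | x <- r] /\ count b r = #|b|].
Proof.
move=> cr; have [f [b [fbP fv bv]]] := creation_ranking cr.
have [vbij _ _] := cr; have [g vK gK] := vbij.
exists f, b; set r := map v _ => /=.
have memr x : x \in r by rewrite -[x]gK map_f ?mem_enum.
have ur : uniq r by rewrite map_inj_uniq ?enum_uniq //; apply: can_inj vK.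
have pr : perm_eq r (enum V).
  by apply: uniq_perm; rewrite ?enum_uniq // => x; rewrite memr mem_enum.
split=> //; first exact: sorted_enum_creation.
  split; last by rewrite -(bij_eq_card vbij) card_ord.
  by have [_ _ [x0 _ _]] := fbP; have := ltn_ord (g x0); lia.
split; last by rewrite (permP pr) enumT cardE size_filter; apply: eq_count.
rewrite -map_comp (eq_map (g := tnth t)) //.
by rewrite map_tnth_enum.
Qed.

(** * Word size and conclusion *)

(** The exponent 5 comes from the case [n = 1], where a power of 2 must exceed 21. *)
Lemma word_bound_large n : 0 < n -> 16 + 3 * n + 2 < word_bound 5 n.
Proof. rewrite /word_bound !expnS expn0; nia. Qed.

Theorem theorem3p25 :
  (forall (R : realType) (V : finType) (G : sgraph V),
     0 < #|V| -> threshold_graph R G -> #|max_indep_sets G| = omega G)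
  /\ (exists (p : program) (c C : nat),
      forall (R : realType) (V : finType) (G : sgraph V)
             (n : nat) (t : n.-tuple bool) (v : 'I_n -> V),
        threshold_graph R G -> creation_sequence G t v ->
        computes_within (word_bound c n) p (C * n)
          (encode_creation t v) [:: #|max_indep_sets G|])
  /\ (exists (p : program) (c C : nat),
      forall (R : realType) (V : finType) (G : sgraph V)
             (n : nat) (t : n.-tuple bool) (v : 'I_n -> V),
        threshold_graph R G -> creation_sequence G t v ->
        exists2 l : seq (seq V),
          enumeration_of (max_indep_sets G) l &
          computes_within (word_bound c n) p (C * (omega G * n))
            (encode_creation t v) (encode_sets l)).
Proof.
split; last split.
- move=> R V G V0 thG; have [f [b fbP]] := threshold_ranking V0 thG.
  by rewrite (card_max_indep_sets_ranking fbP) (omega_ranking fbP).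
(* No word exceeds [n], so the word bound [n + 1] is enough. *)
- exists count_program, 1, 7 => R V G n t v _ /creation_lists.
  case=> f [b [fbP _ _ [n0 _] [tE bE]]].
  rewrite (card_max_indep_sets_ranking fbP) -bE /encode_creation.
  have := @count_program_correct (word_bound 1 n) t [seq label (v i) | i <- enum 'I_n].
  rewrite size_tuple /word_bound expn1 ltnSn => /(_ n0 isT).
  by rewrite [X in count id X]tE count_map.
(* The constant is [28 + 6 + 5]: as [n] and [omega G] are positive, [28 * n + omega G * (6 * n + 5)]
   is at most [39 * (omega G * n)]. *)
- exists enum_program, 5, 39 => R V G n t v _ /creation_lists.
  case=> f [b [fbP memr sr [n0 cV] [tE bE]]].
  set r := map v _ in memr sr tE bE.
  have szr : size r = n by rewrite size_map size_enum_ord.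
  have W18 := word_bound_large n0.
  have labW (x : V) : label x < word_bound 5 n.
    by apply: leq_trans (ltn_ord _) _; rewrite cV; lia.
  exists (mis_lists b (rev r) [::]).
    by apply: (enumeration_mis_lists fbP) => // x; rewrite mem_rev.
  have := @enum_program_correct V b (word_bound 5 n) r.
  rewrite szr => /(_ n0 labW W18) [k [s [kT sE hs oE]]].
  exists k, s; split=> //.
    have b0 : 0 < #|b| by have [_ _ [x0 bx0 _]] := fbP; apply/card_gt0P; exists x0.
    by rewrite (omega_ranking fbP); move: kT; rewrite bE; nia.
  have labE : [seq label (v i) | i <- enum 'I_n] = [seq label x | x <- r].
    by rewrite /r -map_comp.
  by rewrite /encode_creation labE [X in map _ X]tE -map_comp.
Qed.
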